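(* Let $n\ge 2$ be an integer. If $n$ is not prime then the $\mathcal{S}_n$-lattice $A_{n-1}^{\otimes 2}$ is not equivalent (in the sense of $\sim$) to a direct summand of a quasi-permutation $\mathcal{S}_n$-lattice.
   Context: $\mathcal{S}_n$ is the symmetric group on $\{1,\ldots,n\}$. $A_{n-1}=\{(z_1,\ldots,z_n)\in\mathbb{Z}^n\mid\sum_i z_i=0\}$ with $\mathcal{S}_n$ permuting the coordinates of $\mathbb{Z}^n$, and $A_{n-1}^{\otimes 2}=A_{n-1}\otimes_{\mathbb{Z}}A_{n-1}$ with diagonal action. For a finite group $\mathcal{G}$, a $\mathcal{G}$-lattice is a $\mathbb{Z}[\mathcal{G}]$-module that is free of finite rank over $\mathbb{Z}$; a permutation $\mathcal{G}$-lattice is one having a $\mathbb{Z}$-basis permuted by $\mathcal{G}$. Two $\mathcal{G}$-lattices $M,N$ are equivalent, $M\sim N$, if there are exact sequences of $\mathcal{G}$-lattices $0\to M\to E\to P\to 0$ and $0\to N\to E\to Q\to 0$ (same $E$) with $P,Q$ permutation $\mathcal{G}$-lattices. A $\mathcal{G}$-lattice $M$ is quasi-permutation if $M\sim 0$, i.e. if there is an exact sequence of $\mathcal{G}$-lattices $0\to M\to P\to Q\to 0$ with $P,Q$ permutation $\mathcal{G}$-lattices. *)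

(* Defs.v *)
From HB Require Import structures.
From mathcomp Require Import freeg.
From mathcomp Require Import all_boot all_order all_algebra all_fingroup.
From mathcomp Require boolp.

Set Implicit Arguments.
Unset Strict Implicit.
Unset Printing Implicit Defensive.

Import GRing.Theory.
Local Open Scope ring_scope.

Definition is_zbasis (M : zmodType) (r : nat) (b : 'I_r -> M) : Prop :=
  forall x, exists! c : 'rV[int]_r, x = \sum_i b i *~ c 0 i.

(* The acting group is the whole finite group gT, acting on the left. *)
Record glattice (gT : finGroupType) : Type := GLattice {
  gl_sort :> zmodType;
  gl_act : gT -> gl_sort -> gl_sort;
  gl_act1 : forall x, gl_act 1%g x = x;
  gl_actM : forall g h x, gl_act (g * h)%g x = gl_act g (gl_act h x);
  gl_actD : forall g x y, gl_act g (x + y) = gl_act g x + gl_act g y;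
  gl_free : exists (r : nat) (b : 'I_r -> gl_sort), is_zbasis b
}.

Section Lattices.
Variable gT : finGroupType.
Implicit Types M N P Q E L : glattice gT.

Definition permutation_lattice P : Prop :=
  exists (r : nat) (b : 'I_r -> P),
    is_zbasis b /\ forall g i, exists j, gl_act g (b i) = b j.

Definition equivariant M N (f : M -> N) : Prop :=
  forall g x, f (gl_act g x) = gl_act g (f x).

Definition has_ses M E P : Prop :=
  exists (f : {additive M -> E}) (p : {additive E -> P}),
    [/\ equivariant f /\ equivariant p,
        injective f,
        forall y, p y = 0 <-> exists x, f x = y
      & forall z, exists y, p y = z].

Definition equivalent M N : Prop :=
  exists E P Q, [/\ permutation_lattice P, permutation_lattice Q,
                    has_ses M E P & has_ses N E Q].

Definition quasi_permutation M : Prop :=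
  exists P Q, [/\ permutation_lattice P, permutation_lattice Q
                & has_ses M P Q].

Definition isomorphic M N : Prop :=
  exists f : {additive M -> N}, equivariant f /\ bijective f.

End Lattices.

Section ZeroLattice.
Variable gT : finGroupType.

Definition zero_act (g : gT) (x : 'rV[int]_0) : 'rV[int]_0 := x.

Lemma zero_free : exists (r : nat) (b : 'I_r -> 'rV[int]_0), is_zbasis b.
Proof.
exists 0, (fun=> 0) => x; exists 0; split=> [|c _]; apply/rowP; by case.
Qed.

Definition zero_lattice : glattice gT :=
  GLattice (gl_act := zero_act) (fun=> erefl) (fun _ _ _ => erefl)
           (fun _ _ _ => erefl) zero_free.

Lemma quasi_permutationE (M : glattice gT) :
  quasi_permutation M <-> equivalent M zero_lattice.
Proof.
split=> [[P [Q [pP pQ sPQ]]]|[E [P [Q [pP pQ sP sQ]]]]].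
  exists P, Q, P; split=> //.
  have idA : zmod_morphism (fun x : P => x) by [].
  have zA : zmod_morphism (fun x : zero_lattice => 0 : P).
    by move=> x y; rewrite subr0.
  pose i := HB.pack_for {additive P -> P} (fun x : P => x)
    (GRing.isZmodMorphism.Build _ _ _ idA).
  pose z := HB.pack_for {additive zero_lattice -> P}
    (fun x : zero_lattice => 0 : P) (GRing.isZmodMorphism.Build _ _ _ zA).
  exists z, i; split=> [|x y _|y|y].
  - split=> // g x /=; apply: (addrI (gl_act g (0 : P))).
    by rewrite -gl_actD !addr0.
  - by apply/rowP; case.
  - by split=> [yE|[x <-]] //; exists 0; rewrite /= -yE.
  - by exists y.
exists E, P; split=> //.
case: sQ => f [q [[_ eq_q] _ qK q_surj]].
have q_inj : injective q.
  move=> x y qxy; apply/subr0_eq; have /qK[u <-] : q (x - y) = 0.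
    by rewrite raddfB qxy subrr.
  by rewrite (_ : u = 0) ?raddf0 //; apply/rowP; case.
case: pQ => r [b [bB bG]].
have [c cE] : exists c : 'I_r -> E, forall i, q (c i) = b i.
  have ex i : exists y, q y == b i by have [y <-] := q_surj (b i); exists y.
  by exists (fun i => xchoose (ex i)) => i; apply/eqP/(xchooseP (ex i)).
have sumE (d : 'rV[int]_r) : q (\sum_i c i *~ d 0 i) = \sum_i b i *~ d 0 i.
  by rewrite raddf_sum; apply: eq_bigr => i _; rewrite raddfMz cE.
exists r, c; split=> [x|g i].
  have [d [dE dU]] := bB (q x); exists d; split=> [|d' d'E].
    by apply: q_inj; rewrite sumE.
  by apply: dU; rewrite -sumE -d'E.
have [j gij] := bG g i; exists j.
by apply: q_inj; rewrite eq_q !cE.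
Qed.

End ZeroLattice.

Section DirectSum.
Variable gT : finGroupType.
Variables M N : glattice gT.

Definition dsum_act (g : gT) (x : M * N) : M * N :=
  (gl_act g x.1, gl_act g x.2).

Lemma dsum_act1 x : dsum_act 1%g x = x.
Proof. by case: x => x y; rewrite /dsum_act !gl_act1. Qed.

Lemma dsum_actM g h x : dsum_act (g * h)%g x = dsum_act g (dsum_act h x).
Proof. by rewrite /dsum_act !gl_actM. Qed.

Lemma dsum_actD g x y : dsum_act g (x + y) = dsum_act g x + dsum_act g y.
Proof. by rewrite /dsum_act !gl_actD. Qed.

Lemma dsum_free : exists (r : nat) (b : 'I_r -> M * N), is_zbasis b.
Proof.
have [r [b bB]] := gl_free M; have [s [c cB]] := gl_free N.
pose bc (i : 'I_(r + s)) : M * N :=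
  match split i with inl j => (b j, 0) | inr k => (0, c k) end.
have bcE (d : 'rV[int]_(r + s)) : \sum_i bc i *~ d 0 i =
    (\sum_i b i *~ (lsubmx d) 0 i, \sum_i c i *~ (rsubmx d) 0 i).
  have bcl j : bc (lshift s j) = (b j, 0) by rewrite /bc (unsplitK (inl j)).
  have bcr k : bc (rshift r k) = (0, c k) by rewrite /bc (unsplitK (inr k)).
  rewrite [LHS]surjective_pairing (raddf_sum fst) (raddf_sum snd) /=.
  rewrite !big_split_ord /=; congr pair.
    rewrite [X in _ + X]big1 ?addr0 => [|k _].
      by apply: eq_bigr => j _; rewrite (raddfMz fst) bcl mxE.
    by rewrite (raddfMz fst) bcr mul0rz.
  rewrite big1 ?add0r => [|j _]; last by rewrite (raddfMz snd) bcl mul0rz.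
  by apply: eq_bigr => k _; rewrite (raddfMz snd) bcr mxE.
exists (r + s)%N, bc => -[x y].
have [d [dE dU]] := bB x; have [e [eE eU]] := cB y.
exists (row_mx d e); split=> [|f].
  by rewrite bcE row_mxKl row_mxKr -dE -eE.
rewrite bcE -{3}[f]hsubmxK => -[xE yE].
by rewrite -(dU _ xE) -(eU _ yE).
Qed.

Definition dsum : glattice gT :=
  GLattice dsum_act1 dsum_actM dsum_actD dsum_free.

End DirectSum.

Definition direct_summand (gT : finGroupType) (M L : glattice gT) : Prop :=
  exists M' : glattice gT, isomorphic L (dsum M M').

(* The tensor product over the integers: the free abelian group on M * N modulo
   the subgroup generated by the biadditivity relations. *)

Section Tensor.
Variables M N : zmodType.
Local Notation F := {freeg (M * N)%type / int}.

Definition biadditive (W : zmodType) (f : M -> N -> W) : Prop :=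
  (forall x x' y, f (x + x') y = f x y + f x' y) /\
  (forall x y y', f x (y + y') = f x y + f x y').

Definition tens_gen (x : M) (y : N) : F := << 1 *g (x, y) >>.

Definition tens_rel (z : F) : Prop :=
  (exists x x' y,
     z = tens_gen (x + x') y - (tens_gen x y + tens_gen x' y)) \/
  (exists x y y',
     z = tens_gen x (y + y') - (tens_gen x y + tens_gen x y')).

Definition tens_sub : {pred F} := fun z =>
  boolp.asbool (forall S : zmodClosed F,
    (forall u, tens_rel u -> u \in S) -> z \in S).

Lemma tens_subP z : reflect (forall S : zmodClosed F,
  (forall u, tens_rel u -> u \in S) -> z \in S) (z \in tens_sub).
Proof. exact: boolp.asboolP. Qed.

Lemma tens_sub_zmod_closed : zmod_closed tens_sub.
Proof.
split=> [|u v /tens_subP uS /tens_subP vS]; apply/tens_subP => S SR.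
  exact: rpred0.
by rewrite rpredB ?uS ?vS.
Qed.

HB.instance Definition _ := GRing.isZmodClosed.Build F tens_sub
  tens_sub_zmod_closed.

Definition tens : zmodType := Quotient.quot tens_sub.

Definition tmul (x : M) (y : N) : tens := (\pi_tens (tens_gen x y))%qT.

Lemma tens_piB (u v : F) :
  (\pi_tens (u - v) = \pi_tens u - \pi_tens v)%qT.
Proof. exact: (raddfB (\pi_(Quotient.quot tens_sub))%qT). Qed.

Lemma tens_piD (u v : F) :
  (\pi_tens (u + v) = \pi_tens u + \pi_tens v)%qT.
Proof. exact: (raddfD (\pi_(Quotient.quot tens_sub))%qT). Qed.

Lemma tens_pi_eq (u v : F) :
  (\pi_tens u = \pi_tens v)%qT <-> u - v \in tens_sub.
Proof.
have := Quotient.idealrBE tens_sub u v => ->.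
by split=> [/eqP|/eqP].
Qed.

Lemma tmul_biadditive : biadditive tmul.
Proof.
split=> [x x' y|x y y']; rewrite /tmul -tens_piD; apply/tens_pi_eq;
  apply/tens_subP => S; apply.
  by left; exists x, x', y.
by right; exists x, y, y'.
Qed.

Lemma tmulDl x x' y : tmul (x + x') y = tmul x y + tmul x' y.
Proof. exact: tmul_biadditive.1. Qed.

Lemma tmulDr x y y' : tmul x (y + y') = tmul x y + tmul x y'.
Proof. exact: tmul_biadditive.2. Qed.

Lemma tens_ind (P : tens -> Prop) :
    P 0 -> (forall u v, P u -> P v -> P (u - v)) ->
  (forall x y, P (tmul x y)) -> forall t, P t.
Proof.
move=> P0 PB Pt t.
have PN u : P u -> P (- u) by move=> Pu; rewrite -sub0r; apply: PB.
have PD u v : P u -> P v -> P (u + v).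
  by move=> Pu Pv; rewrite -[v]opprK; apply: PB => //; apply: PN.
rewrite -(reprK t) -[X in (\pi X)%qT]freeg_sumE.
rewrite (raddf_sum (\pi_(Quotient.quot tens_sub))%qT).
apply: (big_rec P) => // -[x y] u _ Pu; apply: (PD) => //.
rewrite -[coeff _ _]intz -freegU_mulz.
rewrite (raddfMz (\pi_(Quotient.quot tens_sub))%qT).
have Pn n : P (tmul x y *+ n).
  by elim: n => [|n IHn]; rewrite ?mulr0n ?mulrS //; apply: PD.
by case: (coeff _ _) => n; [apply: Pn | apply/PN/Pn].
Qed.

Lemma tens_ext (W : zmodType) (f g : {additive tens -> W}) :
  (forall x y, f (tmul x y) = g (tmul x y)) -> f =1 g.
Proof.
move=> fg; apply: tens_ind => // [|u v fu fv]; first by rewrite !raddf0.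
by rewrite !raddfB fu fv.
Qed.

Section Lift.
Variables (W : zmodType) (f : M -> N -> W).

Let f' (z : M * N) : zmodule W := f z.1 z.2.

Definition free_lift (z : F) : W := fglift f' z.

Lemma free_lift_zmod_morphism : zmod_morphism free_lift.
Proof. exact: (@lift_is_additive _ _ (zmodule W) f'). Qed.

HB.instance Definition _ := GRing.isZmodMorphism.Build F W free_lift
  free_lift_zmod_morphism.

Definition tens_lift (t : tens) : W := free_lift (generic_quotient.repr t).

Hypothesis f_biadd : biadditive f.

Let ker : {pred F} := fun z => free_lift z == 0.

Let ker_closed : zmod_closed ker.
Proof.
split=> [|u v]; rewrite !unfold_in /ker; first by rewrite raddf0.
by move=> /eqP u0 /eqP v0; rewrite raddfB /= u0 v0 subrr.
Qed.

HB.instance Definition _ := GRing.isZmodClosed.Build F ker ker_closed.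

Let lift_gen x y : free_lift (tens_gen x y) = f x y.
Proof. by rewrite /free_lift liftU scale1r. Qed.

Lemma tens_lift_pi u : tens_lift (\pi_tens u)%qT = free_lift u.
Proof.
have /tens_pi_eq/tens_subP/(_ ker) :
    (\pi_tens (generic_quotient.repr (\pi_tens u)) = \pi_tens u)%qT.
  by rewrite reprK.
move=> kerP.
have {}kerP :
    free_lift (generic_quotient.repr (\pi_tens u)%qT - u) == 0.
  apply: kerP => v vP; rewrite unfold_in; change (free_lift v == 0).
  by case: vP => [[x [x' [y ->]]]|[x [y [y' ->]]]];
    rewrite raddfB raddfD /= !lift_gen ?f_biadd.1 ?f_biadd.2 subrr.
by apply/eqP; rewrite -subr_eq0 -raddfB.
Qed.

Lemma tens_lift_tmul x y : tens_lift (tmul x y) = f x y.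
Proof. by rewrite tens_lift_pi lift_gen. Qed.

Lemma tens_lift_zmod_morphism : zmod_morphism tens_lift.
Proof.
move=> t u; rewrite -(reprK t) -(reprK u) -tens_piB !tens_lift_pi.
exact: raddfB.
Qed.

Definition tens_lift_additive : {additive tens -> W} :=
  HB.pack_for {additive tens -> W} tens_lift
    (GRing.isZmodMorphism.Build _ _ _ tens_lift_zmod_morphism).

End Lift.

Lemma tens_universal (W : zmodType) (f : M -> N -> W) : biadditive f ->
  exists h : {additive tens -> W},
    (forall x y, h (tmul x y) = f x y) /\
    forall k : {additive tens -> W},
      (forall x y, k (tmul x y) = f x y) -> k =1 h.
Proof.
move=> fD; exists (tens_lift_additive fD).
have liftE x y : tens_lift_additive fD (tmul x y) = f x y.
  exact: tens_lift_tmul.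
by split=> // k kE; apply: tens_ext => x y; rewrite kE liftE.
Qed.

End Tensor.

Section ZBasis.
Variables (M : zmodType) (r : nat) (b : 'I_r -> M).
Hypothesis bB : is_zbasis b.

Lemma zbasis_coord : exists c : {additive M -> 'rV[int]_r},
  (forall x, x = \sum_i b i *~ c x 0 i) /\
  (forall d : 'rV[int]_r, c (\sum_i b i *~ d 0 i) = d).
Proof.
have ex (x : M) : exists d : 'rV[int]_r, x == \sum_i b i *~ d 0 i.
  by have [d [dE _]] := bB x; exists d; apply/eqP.
pose c (x : M) : 'rV[int]_r := xchoose (ex x).
have cE x : x = \sum_i b i *~ c x 0 i by apply/eqP/(xchooseP (ex x)).
have cU x (d : 'rV[int]_r) : x = \sum_i b i *~ d 0 i -> c x = d.
  by have [e [_ eU]] := bB x => dE; rewrite -(eU _ dE) -(eU _ (cE x)).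
have cB : zmod_morphism c.
  move=> x y; apply: cU; rewrite {1}[x]cE {1}[y]cE -sumrB.
  by apply: eq_bigr => i _; rewrite !mxE mulrzBr.
exists (HB.pack_for {additive M -> 'rV[int]_r} c
  (GRing.isZmodMorphism.Build _ _ _ cB)).
by split=> // d; apply: cU.
Qed.

End ZBasis.

Section TensorLattice.
Variable gT : finGroupType.
Variables M N : glattice gT.

Definition tensor_act (g : gT) : tens M N -> tens M N :=
  tens_lift (fun x y => tmul (gl_act g x) (gl_act g y)).

Lemma act_biadditive g :
  biadditive (fun (x : M) (y : N) => tmul (gl_act g x) (gl_act g y)).
Proof.
by split=> [x x' y|x y y']; rewrite gl_actD (tmulDl, tmulDr).
Qed.

Lemma tensor_act_tmul g x y :
  tensor_act g (tmul x y) = tmul (gl_act g x) (gl_act g y).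
Proof. exact: (tens_lift_tmul (act_biadditive g)). Qed.

Lemma tensor_actB g : zmod_morphism (tensor_act g).
Proof. exact: tens_lift_zmod_morphism (act_biadditive g). Qed.

HB.instance Definition _ g := GRing.isZmodMorphism.Build _ _ (tensor_act g)
  (tensor_actB g).

Lemma tensor_act1 t : tensor_act 1%g t = t.
Proof.
move: t; apply: (tens_ext (g := idfun)) => x y.
by rewrite /= tensor_act_tmul !gl_act1.
Qed.

Lemma tensor_actM g h t :
  tensor_act (g * h)%g t = tensor_act g (tensor_act h t).
Proof.
move: t; apply: (tens_ext (g := tensor_act g \o tensor_act h)) => x y /=.
by rewrite !tensor_act_tmul !gl_actM.
Qed.

Lemma tensor_actD g t u :
  tensor_act g (t + u) = tensor_act g t + tensor_act g u.
Proof. exact: raddfD. Qed.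

Lemma tensor_free : exists (r : nat) (b : 'I_r -> tens M N), is_zbasis b.
Proof.
have [r [b /zbasis_coord[c [cE cK]]]] := gl_free M.
have [s [b' /zbasis_coord[c' [cE' cK']]]] := gl_free N.
have phiD : biadditive (fun x y => (c x)^T *m c' y).
  split=> [x x' y|x y y']; first by rewrite raddfD raddfD /= mulmxDl.
  by rewrite raddfD /= mulmxDr.
pose phi := tens_lift_additive phiD.
have phiE x y : phi (tmul x y) = (c x)^T *m c' y by apply: tens_lift_tmul.
pose psi (D : 'M[int]_(r, s)) := \sum_i \sum_j tmul (b i) (b' j) *~ D i j.
have psiB : zmod_morphism psi.
  move=> D E; rewrite /psi -sumrB; apply: eq_bigr => i _.
  by rewrite -sumrB; apply: eq_bigr => j _; rewrite !mxE mulrzBr.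
pose psi' := HB.pack_for {additive 'M[int]_(r, s) -> tens M N} psi
  (GRing.isZmodMorphism.Build _ _ _ psiB).
have tB_l y : zmod_morphism (fun x : M => tmul x (y : N)).
  by move=> x x'; apply: (addIr (tmul x' y)); rewrite subrK -tmulDl subrK.
have tB_r x : zmod_morphism (tmul (x : M) : N -> _).
  by move=> y y'; apply: (addIr (tmul x y')); rewrite subrK -tmulDr subrK.
pose tl y := HB.pack_for {additive M -> tens M N} (fun x : M => tmul x (y : N))
  (GRing.isZmodMorphism.Build _ _ _ (tB_l y)).
pose tr x := HB.pack_for {additive N -> tens M N} (tmul (x : M) : N -> _)
  (GRing.isZmodMorphism.Build _ _ _ (tB_r x)).
have tl_sum (y : N) (d : 'rV[int]_r) :
    tmul (\sum_i b i *~ d 0 i) y = \sum_i tmul (b i) y *~ d 0 i.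
  have := raddf_sum (tl y) (index_enum _) xpredT (fun i => b i *~ d 0 i).
  by move=> /= ->; apply: eq_bigr => i _; apply: (raddfMz (tl y)).
have tr_sum (x : M) (d : 'rV[int]_s) :
    tmul x (\sum_i b' i *~ d 0 i) = \sum_i tmul x (b' i) *~ d 0 i.
  have := raddf_sum (tr x) (index_enum _) xpredT (fun i => b' i *~ d 0 i).
  by move=> /= ->; apply: eq_bigr => i _; apply: (raddfMz (tr x)).
have psiK : forall t, psi (phi t) = t.
  apply: (tens_ext (f := psi' \o phi) (g := idfun)) => x y.
  change (psi (phi (tmul x y)) = tmul x y).
  rewrite phiE /psi [in RHS](cE x) tl_sum; apply: eq_bigr => i _.
  rewrite [in RHS](cE' y) tr_sum mulrz_suml; apply: eq_bigr => j _.
  by rewrite -mulrzA !mxE big_ord1 !mxE mulrC.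
have c_b i : c (b i) = delta_mx 0 i.
  rewrite -[RHS]cK (bigD1 i) //= big1 ?addr0 => [|j /negPf ji].
    by rewrite mxE !eqxx.
  by rewrite mxE ji.
have c_b' i : c' (b' i) = delta_mx 0 i.
  rewrite -[RHS]cK' (bigD1 i) //= big1 ?addr0 => [|j /negPf ji].
    by rewrite mxE !eqxx.
  by rewrite mxE ji.
have phiK D : phi (psi D) = D.
  rewrite [RHS]matrix_sum_delta raddf_sum; apply: eq_bigr => i _.
  rewrite raddf_sum; apply: eq_bigr => j _; rewrite raddfMz phiE c_b c_b'.
  by rewrite trmx_delta mul_delta_mx -scaler_int intz.
pose e (k : 'I_(r * s)) :=
  let ij := enum_val (cast_ord (esym (mxvec_cast r s)) k)
  in tmul (b ij.1) (b' ij.2).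
have eE (d : 'rV[int]_(r * s)) : \sum_k e k *~ d 0 k = psi (vec_mx d).
  rewrite /psi pair_bigA (reindex _ (curry_mxvec_bij r s)) /=.
  apply: eq_bigr => -[i j] _ /=.
  by rewrite /e /mxvec_index cast_ordK enum_rankK mxE.
exists (r * s)%N, e => t; exists (mxvec (phi t)); split.
  by rewrite eE mxvecK psiK.
by move=> d; rewrite eE => ->; rewrite phiK vec_mxK.
Qed.

Definition tensor : glattice gT :=
  GLattice tensor_act1 tensor_actM tensor_actD tensor_free.

End TensorLattice.

(* root_lattice n is A_{n-1}. In 'S_n, (s * t) i = t (s i), so permuting
   coordinates by (s z)_i = z_(s i) is a left action. *)

Section RootLattice.
Variable n : nat.

Definition sum0 : {pred 'rV[int]_n} := fun z => \sum_i z 0 i == 0.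

Lemma sum0_zmod_closed : zmod_closed sum0.
Proof.
split=> [|x y]; rewrite !unfold_in /sum0.
  by rewrite big1 // => i _; rewrite mxE.
move=> /eqP x0 /eqP y0; rewrite (eq_bigr (fun i => x 0 i - y 0 i)).
  by rewrite sumrB x0 y0 subrr.
by move=> i _; rewrite !mxE.
Qed.

HB.instance Definition _ := GRing.isZmodClosed.Build _ sum0 sum0_zmod_closed.

Record root_vec : Type := RootVec {
  root_val :> 'rV[int]_n;
  root_valP : root_val \in sum0
}.

HB.instance Definition _ := [isSub for root_val].
HB.instance Definition _ := [Choice of root_vec by <:].
HB.instance Definition _ := [SubChoice_isSubZmodule of root_vec by <:].

Lemma col_perm_sum0 (s : 'S_n) (z : 'rV[int]_n) :
  z \in sum0 -> col_perm s z \in sum0.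
Proof.
rewrite !unfold_in /sum0 => /eqP z0; apply/eqP.
rewrite -[RHS]z0 [RHS](reindex_inj (@perm_inj _ s)).
by apply: eq_bigr => i _; rewrite mxE.
Qed.

Definition root_act (s : 'S_n) (z : root_vec) : root_vec :=
  RootVec (col_perm_sum0 s (root_valP z)).

Lemma root_act1 z : root_act 1%g z = z.
Proof. by apply: val_inj; rewrite /= col_perm1. Qed.

Lemma root_actM s t z : root_act (s * t)%g z = root_act s (root_act t z).
Proof. by apply: val_inj; rewrite /= col_permM. Qed.

Lemma root_actD s x y : root_act s (x + y) = root_act s x + root_act s y.
Proof. by apply: val_inj; apply/rowP => i; rewrite !mxE. Qed.

End RootLattice.

Lemma root_free n : exists (r : nat) (b : 'I_r -> root_vec n), is_zbasis b.
Proof.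
case: n => [|n].
  exists 0, (fun=> 0) => x; exists 0; split=> [|c _]; last by apply/rowP; case.
  by apply: val_inj; apply/rowP; case.
have sum_eq (k : 'I_n.+1) : \sum_j (j == k)%:R = 1 :> int.
  by rewrite (bigD1 k) //= eqxx big1 ?addr0 // => j /negPf->.
have bP (i : 'I_n) :
    (delta_mx 0 (lift ord0 i) - delta_mx 0 ord0 : 'rV[int]_n.+1)
       \in @sum0 n.+1.
  rewrite unfold_in /sum0.
  rewrite (eq_bigr (fun k => (k == lift ord0 i)%:R - (k == ord0)%:R)).
    by rewrite sumrB !sum_eq subrr.
  by move=> k _; rewrite !mxE.
pose b i := RootVec (bP i).
pose v : {additive root_vec n.+1 -> 'rV[int]_n.+1} := \val.
have vE (d : 'rV[int]_n) :
    root_val (\sum_i b i *~ d 0 i) = \sum_i root_val (b i) *~ d 0 i.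
  have /= -> := raddf_sum v (index_enum _) xpredT (fun i => b i *~ d 0 i).
  by apply: eq_bigr => i _; apply: (raddfMz v).
have bE (d : 'rV[int]_n) j :
    root_val (\sum_i b i *~ d 0 i) 0 (lift ord0 j) = d 0 j.
  rewrite vE summxE (bigD1 j) //= -scaler_int intz !mxE /= eqxx subr0 mulr1.
  rewrite big1 ?addr0 // => i ij; rewrite -scaler_int intz !mxE /=.
  by rewrite (inj_eq lift_inj) eq_sym (negPf ij) subr0 mulr0.
have root_eq (x y : root_vec n.+1) :
    (forall j, x 0 (lift ord0 j) = y 0 (lift ord0 j)) -> x = y.
  move=> xy; apply: val_inj; apply/rowP => k.
  have [j ->|->] := unliftP ord0 k; first exact: xy.
  have sum0E (z : root_vec n.+1) :
      root_val z 0 ord0 + \sum_(i < n) root_val z 0 (lift ord0 i) = 0.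
    by rewrite -big_ord_recl; apply/eqP/(root_valP z).
  apply: (addIr (\sum_(i < n) root_val y 0 (lift ord0 i))).
  by rewrite sum0E -(eq_bigr _ (fun j _ => xy j)) sum0E.
exists n, b => x; exists (\row_j x 0 (lift ord0 j)); split.
  by apply: root_eq => j; rewrite bE mxE.
by move=> d ->; apply/rowP => j; rewrite mxE bE.
Qed.

Definition root_lattice (n : nat) : glattice {perm 'I_n} :=
  GLattice (@root_act1 n) (@root_actM n) (@root_actD n) (root_free n).

(* Main.v *)
From HB Require Import structures.
Require Import Defs.
From mathcomp Require Import all_boot all_order all_algebra all_fingroup.
From mathcomp Require Import ring zify.

(** The obstruction is the kernel of
      H^2(H, M) -> prod_(h in H) H^2(<h>, M)
    for a subgroup H of the acting group.  Permutation lattices P have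
    H^1(H, P) = 0, and this kernel vanishes for them: by Shapiro's lemma it
    consists of homomorphisms from point stabilisers to Q/Z that vanish on
    every cyclic subgroup.  Long exact sequences then show that an extension
    0 -> M -> E -> P -> 0 by a permutation lattice P gives M and E the same
    kernel, so the vanishing passes to quasi-permutation lattices, to their
    summands, and to everything equivalent to those.

    Two-cocycles do not appear.  As M is torsion-free, the classes killed by e
    in H^2(H, M) are the Bocksteins of the one-cocycles of H in M / e M, and
    such a Bockstein vanishes exactly when the cocycle lifts to a cocycle with
    values in M.  The e-torsion of the kernel is therefore zero if and
    only if every cocycle mod e that lifts over each cyclic subgroup of H lifts
    over H; this is [sha_trivial e H M].

    For A = A_(n-1) inside U = Z^n, tensoring 0 -> A -> U -> Z -> 0 with A
    gives 0 -> A (x) A -> A (x) U -> A -> 0 with A (x) U a permutation lattice,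
    so a class of H^1(H, A) that is trivial on cyclic subgroups yields an
    element of the kernel for A (x) A, nonzero if the class is.  The cocycle
    g |-> g c - c, for c in U with coordinate sum k, is a coboundary in A if
    and only if some invariant vector of U has sum k.  Hence the kernel for
    A (x) A is nonzero as soon as each h in H fixes a vector of sum k, while
    H fixes none ([root_tensor_sha_nontrivial]).

    When n is composite, n = m p with p its least prime factor and p <= m, and
    H can be taken to be the image of an action of F_p^2 on n points.  If m = p,
    the regular action works with k = p: invariant vectors have sums divisible
    by p^2, but an affine line in the direction of h is an h-invariant set of p
    points.  If m > p, F_p^2 acts on m orbits of p points whose kernels exhaust
    the p + 1 lines of F_p^2, and k = 1: each element has a fixed point, but
    invariant vectors have sums divisible by p. *)

Set Implicit Arguments.
Unset Strict Implicit.
Unset Printing Implicit Defensive.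

Import GRing.Theory Num.Theory.
Local Open Scope ring_scope.

(** * Cocycles with values in functions on a finite set *)

Section PermutationCocycles.
Variables (gT : finGroupType) (X : finType) (act : gT -> X -> X).
Hypothesis act1 : forall x, act 1%g x = x.
Hypothesis actM : forall g h x, act (g * h)%g x = act g (act h x).

(** The group acts on functions by (g f)(g x) = f x; the condition is the
    cocycle identity modulo e, read at the point g x.  For e = 0 it is exact,
    since 0 divides only 0. *)
Definition fun_cocycle (e : int) (K : {set gT}) (y : gT -> X -> int) : Prop :=
  {in K &, forall g h x,
    (e %| y (g * h)%g (act g x) - (y g (act g x) + y h x))%Z}.

(** On the stabiliser of x the values at x form a homomorphism from a finite
    group to the integers, which is zero. *)
Lemma fun_cocycle_fix (k : gT) (z : gT -> X -> int) x :
  fun_cocycle 0 <[k]>%g z -> act k x = x -> z k x = 0.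
Proof.
move=> zP kx; have kk := cycle_id k.
have zE g h : g \in <[k]>%g -> h \in <[k]>%g -> act g x = x ->
    z (g * h)%g x = z g x + z h x.
  move=> gk hk gx; have := zP g h gk hk x.
  by rewrite gx dvd0z subr_eq0 => /eqP.
have z1 : z 1%g x = 0.
  by apply: (addrI (z 1%g x)); rewrite -zE ?act1 ?mulg1 ?addr0 // group1.
have zX i : z (k ^+ i)%g x = z k x *+ i.
  elim: i => [|i IHi]; first by rewrite expg0 z1.
  by rewrite expgS zE ?mem_cycle // IHi mulrS.
have /eqP := zX #[k]%g; rewrite expg_order z1 eq_sym.
by rewrite mulrn_eq0 -leqn0 leqNgt order_gt0 => /eqP.
Qed.

(** Shapiro's lemma in degree one: if t x carries the chosen representative of
    the orbit of x to x, then w x = y (t x) x is a primitive of y.  Another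
    choice of t x changes w x by a value of y on a stabiliser, hence by a
    multiple of e. *)
Lemma fun_cocycle_coboundary (H : {group gT}) (e : int) (y : gT -> X -> int) :
    fun_cocycle e H y ->
    (forall g x, g \in H -> act g x = x -> (e %| y g x)%Z) ->
  exists w : X -> int, forall g x, g \in H ->
    (e %| y g (act g x) - (w (act g x) - w x))%Z.
Proof.
move=> yP yfix.
pose conn x u := [exists g in H, act g u == x].
have connP x u : reflect (exists2 g, g \in H & act g u = x) (conn x u).
  by apply: (iffP exists_inP) => -[g gH /eqP gu]; exists g => //; apply/eqP.
have conn_refl x : conn x x by apply/connP; exists 1%g.
pose rep x := choose (conn x) x.
have repP x : conn x (rep x) by apply: chooseP.
have rep_act g x : g \in H -> rep (act g x) = rep x.
  move=> gH; rewrite /rep; have E : conn (act g x) =1 conn x.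
    move=> u; apply/connP/connP => -[h hH hu].
      exists (g^-1 * h)%g; first by rewrite groupM ?groupV.
      by rewrite actM hu -actM mulVg act1.
    by exists (g * h)%g; rewrite ?groupM // actM hu.
  by rewrite (eq_choose E); apply: choose_id; [rewrite -E |]; apply: conn_refl.
have /fin_all_exists[t tP] x : exists g, g \in H /\ act g (rep x) = x.
  by have /connP[g gH gx] := repP x; exists g.
exists (fun x => y (t x) x) => g x gH; set x' := act g x.
have [tH tx] := tP x; have [tH' tx'] := tP x'.
have repE : rep x' = rep x by apply: rep_act.
pose k := ((t x')^-1 * (g * t x))%g.
have kH : k \in H by rewrite !groupM ?groupV.
have kx : act k (rep x) = rep x.
  by rewrite /k !actM tx -/x' -[X in act _ X]tx' -actM mulVg act1 repE.
have := yP _ _ tH' kH (rep x); rewrite -repE tx' repE /k mulKVg -/k.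
have := yP _ _ gH tH x; have := yfix _ _ kH kx; rewrite -/x'.
case/dvdzP=> q1 E1 /dvdzP[q2 E2] /dvdzP[q3 E3]; apply/dvdzP.
exists (q3 - q2 + q1); rewrite !mulrDl mulNr -E1 -E2 -E3; ring.
Qed.

End PermutationCocycles.

(** * Locally liftable cocycles modulo an integer *)

Section Lattices.
Variable gT : finGroupType.
Implicit Types (M N P Q E L : glattice gT) (e : nat).

Lemma gl_act_zmod_morphism M (g : gT) : zmod_morphism (@gl_act gT M g).
Proof.
by move=> x y; apply: (addIr (gl_act g y)); rewrite -gl_actD !subrK.
Qed.

HB.instance Definition _ M (g : gT) :=
  GRing.isZmodMorphism.Build M M (@gl_act gT M g) (gl_act_zmod_morphism g).

Lemma glattice_torsion_free M e (x : M) : (0 < e)%N -> x *+ e = 0 -> x = 0.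
Proof.
move=> e_gt0 xe0; have [r [b /zbasis_coord[c [cE _]]]] := gl_free M.
suff c0 : c x = 0 by rewrite (cE x) c0 big1 // => i _; rewrite mxE mulr0z.
apply/rowP => i; have /rowP/(_ i)/eqP : c x *+ e = 0.
  by rewrite -raddfMn xe0 raddf0.
by rewrite mulmxnE !mxE mulrn_eq0 -leqn0 leqNgt e_gt0 => /eqP.
Qed.

Definition congr_mod e (M : zmodType) (x y : M) : Prop :=
  exists t, x - y = t *+ e.

(** Cocycles with values in M / e M, represented by functions to M.  The exact
    cocycles are the case e = 0. *)
Definition cocycle e M (K : {set gT}) (s : gT -> M) : Prop :=
  {in K &, forall g h, congr_mod e (s (g * h)%g) (s g + gl_act g (s h))}.

Definition liftable e M (K : {set gT}) (s : gT -> M) : Prop :=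
  exists2 z, cocycle 0 K z & {in K, forall g, congr_mod e (s g) (z g)}.

Definition locally_liftable e M (K : {set gT}) (s : gT -> M) : Prop :=
  {in K, forall k, liftable e <[k]>%g s}.

(** The lifting property says that the e-torsion of the kernel of
    H^2(H, M) -> prod_(h in H) H^2(<h>, M) is zero, classes being represented
    by their preimages under the Bockstein map. *)
Definition sha_trivial e (H : {group gT}) M : Prop :=
  forall s : gT -> M,
    cocycle e H s -> locally_liftable e H s -> liftable e H s.


Lemma congr_mod0 (M : zmodType) (x y : M) : congr_mod 0 x y -> x = y.
Proof. by case=> t /subr0_eq. Qed.

Lemma congr_mod_refl e (M : zmodType) (x : M) : congr_mod e x x.
Proof. by exists 0; rewrite subrr mul0rn. Qed.

Lemma congr_mod_sym e (M : zmodType) (x y : M) :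
  congr_mod e x y -> congr_mod e y x.
Proof. by case=> t xy; exists (- t); rewrite mulNrn -xy opprB. Qed.

Lemma congr_mod_trans e (M : zmodType) (y x z : M) :
  congr_mod e x y -> congr_mod e y z -> congr_mod e x z.
Proof.
by case=> t xy [u yz]; exists (t + u); rewrite mulrnDl -xy -yz addrA subrK.
Qed.

Lemma congr_modB e (M : zmodType) (x y x' y' : M) :
  congr_mod e x y -> congr_mod e x' y' -> congr_mod e (x - x') (y - y').
Proof.
case=> t xy [u xy']; exists (t - u).
by rewrite mulrnBl -xy -xy' !opprD !opprK addrACA.
Qed.

Lemma congr_modD e (M : zmodType) (x y x' y' : M) :
  congr_mod e x y -> congr_mod e x' y' -> congr_mod e (x + x') (y + y').
Proof.
by case=> t xy [u xy']; exists (t + u); rewrite mulrnDl -xy -xy' opprD addrACA.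
Qed.

Lemma congr_mod_additive e (M N : zmodType) (f : {additive M -> N}) x y :
  congr_mod e x y -> congr_mod e (f x) (f y).
Proof. by case=> t xy; exists (f t); rewrite -raddfB xy raddfMn. Qed.

Definition coboundary M (v : M) (g : gT) : M := v - gl_act g v.

Lemma coboundary_cocycle e M (K : {set gT}) (v : M) :
  cocycle e K (coboundary v).
Proof.
move=> g h _ _; rewrite /coboundary gl_actM raddfB /= addrA subrK.
exact: congr_mod_refl.
Qed.

Lemma coboundary_additive M N (f : {additive M -> N}) v g :
  equivariant f -> f (coboundary v g) = coboundary (f v) g.
Proof. by move=> fG; rewrite /coboundary raddfB fG. Qed.

Lemma cocycleS e M (K K' : {set gT}) (s : gT -> M) :
  K' \subset K -> cocycle e K s -> cocycle e K' s.
Proof. by move=> /subsetP sK sP g h gK hK; apply: sP; apply: sK. Qed.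

Lemma cocycleB e M (K : {set gT}) (s s' : gT -> M) :
  cocycle e K s -> cocycle e K s' -> cocycle e K (fun g => s g - s' g).
Proof.
move=> sP sP' g h gK hK; rewrite raddfB addrACA -opprD.
by apply: congr_modB; [apply: sP | apply: sP'].
Qed.

Lemma cocycle_congr e M (H : {group gT}) (s s' : gT -> M) :
    {in H, forall g, congr_mod e (s g) (s' g)} ->
  cocycle e H s -> cocycle e H s'.
Proof.
move=> ss' sP g h gH hH.
have := ss' _ (groupM gH hH); move/congr_mod_sym/congr_mod_trans; apply.
apply: congr_mod_trans (sP _ _ gH hH) _.
by apply: congr_modD; [apply: ss' | apply/congr_mod_additive/ss'].
Qed.

Lemma cocycle_additive e M N (f : {additive M -> N}) (K : {set gT}) s :
  equivariant f -> cocycle e K s -> cocycle e K (f \o s).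
Proof.
move=> fG sP g h gK hK; rewrite /= -fG -raddfD.
exact/congr_mod_additive/sP.
Qed.

Lemma liftable_additive e M N (f : {additive M -> N}) (K : {set gT}) s :
  equivariant f -> liftable e K s -> liftable e K (f \o s).
Proof.
move=> fG [z zP sz]; exists (f \o z); first exact: cocycle_additive.
by move=> g gK; apply/congr_mod_additive/sz.
Qed.

Lemma sha_trivial_retract e (H : {group gT}) L N
    (i : {additive N -> L}) (q : {additive L -> N}) :
    equivariant i -> equivariant q -> cancel i q ->
  sha_trivial e H L -> sha_trivial e H N.
Proof.
move=> iG qG iK shaL s sP sloc.
have [||z zP sz] := shaL (i \o s).
- exact: cocycle_additive.
- by move=> k kH; apply/liftable_additive/sloc.
exists (q \o z); first exact: cocycle_additive.
by move=> g gH; rewrite -(iK (s g)); apply/congr_mod_additive/sz.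
Qed.

Lemma sha_trivial_summand e (H : {group gT}) N L :
  direct_summand N L -> sha_trivial e H L -> sha_trivial e H N.
Proof.
case=> N' [f [fG [f' fK f'K]]].
have f'B : zmod_morphism f' := can2_zmod_morphism fK f'K.
have iB : zmod_morphism (fun x : N => f' (x, 0)).
  by move=> x y; rewrite -f'B; congr f'; congr pair; rewrite subr0.
have qB : zmod_morphism (fun u : L => (f u).1 : N).
  by move=> u v; rewrite raddfB.
pose i := HB.pack_for {additive N -> L} (fun x : N => f' (x, 0))
  (GRing.isZmodMorphism.Build _ _ _ iB).
pose q := HB.pack_for {additive L -> N} (fun u : L => (f u).1 : N)
  (GRing.isZmodMorphism.Build _ _ _ qB).
apply: (sha_trivial_retract (i := i) (q := q)).
- move=> g x; apply: (can_inj fK); rewrite /= fG !f'K.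
  by congr pair; rewrite raddf0.
- by move=> g u; rewrite /= fG.
- by move=> x; rewrite /= f'K.
Qed.

(** The basis of a permutation lattice only comes with the existence of g b_i
    among the b_j; uniqueness of coordinates turns this into an action on the
    indices. *)
Lemma permutation_lattice_coord P : permutation_lattice P ->
  exists (r : nat) (act : gT -> 'I_r -> 'I_r) (c : {additive P -> 'rV[int]_r}),
    [/\ forall x, act 1%g x = x,
        forall g h x, act (g * h)%g x = act g (act h x),
        injective c,
        forall d, exists x, c x = d
      & forall g x i, c (gl_act g x) 0 (act g i) = c x 0 i].
Proof.
case=> r [b [bB bG]]; have [c [cE cK]] := zbasis_coord bB.
have b_sum i : b i = \sum_j b j *~ (delta_mx 0 i : 'rV[int]_r) 0 j.
  rewrite (bigD1 i) //= big1 ?addr0 => [|j /negPf ji].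
    by rewrite mxE !eqxx.
  by rewrite mxE ji.
have cb i : c (b i) = delta_mx 0 i by rewrite b_sum cK.
have b_inj : injective b.
  move=> i j /(congr1 c); rewrite !cb => /rowP/(_ i).
  by rewrite !mxE !eqxx; case: eqP.
have /fin_all_exists[act actE] g :
    exists f : 'I_r -> 'I_r, forall i, gl_act g (b i) = b (f i).
  exact: fin_all_exists (bG g).
have act1 i : act 1%g i = i by apply: b_inj; rewrite -actE gl_act1.
have actM g h i : act (g * h)%g i = act g (act h i).
  by apply: b_inj; rewrite -!actE gl_actM.
have act_inj g : injective (act g).
  by apply: (can_inj (g := act g^-1%g)) => i; rewrite -actM mulVg act1.
exists r, act, c; split=> // [x y xy|d|g x i].
- by rewrite (cE x) xy -cE.
- by exists (\sum_i b i *~ d 0 i).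
rewrite [in LHS](cE x) raddf_sum raddf_sum summxE (bigD1 i) //=.
rewrite big1 ?addr0 => [|j /negPf ji].
  by rewrite !raddfMz /= actE cb -scaler_int mxE mxE !eqxx mulr1 intz.
rewrite !raddfMz /= actE cb -scaler_int mxE mxE (inj_eq (@act_inj g)).
by rewrite eq_sym ji mulr0.
Qed.

(** Local liftability enters only through the stabilisers: if k fixes an index
    i, an exact cocycle on <k> has i-th coordinate 0 at k, so the i-th
    coordinate of y k is divisible by e. *)
Lemma permutation_coboundary e P (H : {group gT}) (y : gT -> P) :
    permutation_lattice P -> cocycle e H y -> locally_liftable e H y ->
  exists v, {in H, forall g, congr_mod e (y g) (coboundary v g)}.
Proof.
move=> /permutation_lattice_coord[r [act [c [act1 actM c_inj c_surj cG]]]].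
move=> yP yloc.
have cB x x' i : c (x - x') 0 i = c x 0 i - c x' 0 i.
  by rewrite raddfB !mxE.
have congr_dvd a x x' i :
    congr_mod a x x' -> (a%:Z %| (c x 0 i - c x' 0 i)%R)%Z.
  case=> t xx'; apply/dvdzP; exists (c t 0 i).
  by rewrite -cB xx' raddfMn mulmxnE -mulr_natr natz.
have fun_cocycleP a K (z : gT -> P) : cocycle a K z ->
    fun_cocycle act a K (fun g i => c (z g) 0 i).
  move=> zP g h gK hK i; have := congr_dvd _ _ _ (act g i) (zP g h gK hK).
  by rewrite raddfD !mxE cG.
have [|w wP] := fun_cocycle_coboundary act1 actM (fun_cocycleP _ _ _ yP).
  move=> k i kH ki; have [z zP yz] := yloc k kH.
  have := congr_dvd _ _ _ i (yz k (cycle_id k)).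
  by rewrite (fun_cocycle_fix act1 (fun_cocycleP _ _ _ zP) ki) subr0.
have [v cv] := c_surj (\row_i w i); exists v => g gH.
have /fin_all_exists[q qP] i :
    exists q, c (y g - coboundary v g) 0 i = q * e%:Z.
  have [j ->] : exists j, i = act g j.
    by exists (act g^-1%g i); rewrite -actM mulgV act1.
  have cobE : c (coboundary v g) 0 (act g j) = w (act g j) - w j.
    by rewrite cB cG cv !mxE.
  apply/dvdzP; have := wP g j gH.
  by rewrite cB cobE.
have [t ct] := c_surj (\row_i q i); exists t; apply: c_inj.
by apply/rowP => i; rewrite qP raddfMn mulmxnE ct mxE -mulr_natr natz.
Qed.

(** Vanishing of H^1(H, P): the preceding lemma with e = 0, an exact cocycle
    being its own local lift. *)
Lemma permutation_cocycle_coboundary P (H : {group gT}) (y : gT -> P) :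
    permutation_lattice P -> cocycle 0 H y ->
  exists v, {in H, forall g, y g = coboundary v g}.
Proof.
move=> permP yP; have [|v vP] := permutation_coboundary permP yP.
  move=> k kH; exists y; first by apply: cocycleS yP; rewrite cycle_subG.
  by move=> g _; apply: congr_mod_refl.
by exists v => g gH; apply/congr_mod0/vP.
Qed.

Lemma sha_trivial_permutation e (H : {group gT}) P :
  permutation_lattice P -> sha_trivial e H P.
Proof.
move=> permP s sP sloc.
have [v vP] := permutation_coboundary permP sP sloc.
by exists (coboundary v) => //; apply: coboundary_cocycle.
Qed.

(** * Invariance under extensions by permutation lattices *)

Section ShortExactSequence.
Variables (e : nat) (M E P : glattice gT).
Variables (i : {additive M -> E}) (p : {additive E -> P}).
Hypotheses (e_gt0 : (0 < e)%N) (iG : equivariant i) (pG : equivariant p).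
Hypotheses (i_inj : injective i) (p_surj : forall z, exists y, p y = z).
Hypothesis p_ker : forall y, p y = 0 <-> exists x, i x = y.
Hypothesis permP : permutation_lattice P.

(** The image of M is a pure subgroup of E because P is torsion-free. *)
Lemma congr_mod_inj x y : congr_mod e (i x) (i y) -> congr_mod e x y.
Proof.
case=> t xy; have pt0 : p t = 0.
  apply: (glattice_torsion_free e_gt0).
  by rewrite -raddfMn -xy; apply/p_ker; exists (x - y); rewrite raddfB.
have /p_ker[u ut] := pt0; exists u; apply: i_inj.
by rewrite raddfB xy raddfMn ut.
Qed.

(** A lift z of i m with values in E has p z = e y for an exact cocycle y of P.
    Since H^1(H, P) = 0, subtracting e times a coboundary moves z into M without
    changing it modulo e. *)
Lemma liftable_sub (H : {group gT}) (m : gT -> M) (z : gT -> E) :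
    cocycle 0 H z -> {in H, forall g, congr_mod e (i (m g)) (z g)} ->
  liftable e H m.
Proof.
move=> zP mz.
have pi0 x : p (i x) = 0 by apply/p_ker; exists x.
have /fin_all_exists[y yE] g : exists y, g \in H -> p (z g) = y *+ e.
  have [gH|] := boolP (g \in H); last by exists 0.
  have [t tE] := mz g gH; exists (- p t) => _.
  by rewrite mulNrn -raddfMn -tE raddfB pi0 sub0r opprK.
have yP : cocycle 0 H y.
  move=> g h gH hH; exists 0; rewrite mul0rn.
  apply: (glattice_torsion_free e_gt0).
  rewrite mulrnBl mulrnDl -raddfMn /= -!yE ?groupM // -pG -raddfD -raddfB.
  by rewrite (congr_mod0 (zP g h gH hH)) subrr raddf0.
have [v vP] := permutation_cocycle_coboundary permP yP.
have [v' v'E] := p_surj v.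
have /fin_all_exists[z' z'E] g :
    exists x, g \in H -> i x = z g - coboundary v' g *+ e.
  have [gH|] := boolP (g \in H); last by exists 0.
  have [|x xE] := (p_ker (z g - coboundary v' g *+ e)).1; last by exists x.
  by rewrite raddfB raddfMn /= coboundary_additive // v'E -vP // yE // subrr.
exists z' => [g h gH hH|g gH].
  exists 0; rewrite mul0rn; apply/eqP; rewrite subr_eq0; apply/eqP/i_inj.
  rewrite raddfD iG !z'E ?groupM // (raddfB (gl_act g)).
  rewrite (raddfMn (gl_act g)) /= addrACA -opprD -mulrnDl.
  rewrite (congr_mod0 (zP g h gH hH)).
  by rewrite (congr_mod0 (@coboundary_cocycle 0 _ H v' g h gH hH)).
apply: congr_mod_inj; apply: congr_mod_trans (mz g gH) _.
by rewrite z'E //; exists (coboundary v' g); rewrite opprB addrC subrK.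
Qed.

Lemma sha_trivial_sub (H : {group gT}) : sha_trivial e H E -> sha_trivial e H M.
Proof.
move=> shaE s sP sloc; have [||z zP sz] := shaE (i \o s).
- exact: cocycle_additive.
- by move=> k kH; apply/liftable_additive/sloc.
exact: liftable_sub zP sz.
Qed.

(** The image p s in P is locally liftable, hence a coboundary modulo e.
    Subtracting a coboundary of E therefore brings s into M modulo e, and the
    local lifts follow by [liftable_sub] applied to cyclic subgroups. *)
Lemma sha_trivial_extension (H : {group gT}) :
  sha_trivial e H M -> sha_trivial e H E.
Proof.
move=> shaM s sP sloc.
have [v vP] : exists v,
    {in H, forall g, congr_mod e (p (s g)) (coboundary v g)}.
  apply: (permutation_coboundary permP (y := p \o s)).
    exact: cocycle_additive.
  by move=> k kH; apply/liftable_additive/sloc.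
have [v' v'E] := p_surj v.
have /fin_all_exists[m mE] g :
    exists x, g \in H -> congr_mod e (s g - coboundary v' g) (i x).
  have [gH|] := boolP (g \in H); last by exists 0.
  have [t tE] := vP g gH; have [t' t'E] := p_surj t.
  have [|x xE] := (p_ker (s g - coboundary v' g - t' *+ e)).1.
    by rewrite 2!(raddfB p) raddfMn /= coboundary_additive // v'E t'E tE subrr.
  by exists x => _; exists t'; rewrite xE opprB addrC subrK.
have mP : cocycle e H m.
  move=> g h gH hH; apply: congr_mod_inj; rewrite raddfD iG.
  have := cocycle_congr mE (cocycleB sP (@coboundary_cocycle e _ H v')).
  exact.
have [|z zP mz] := shaM m mP.
  move=> k kH; have [z zP sz] := sloc k kH.
  apply: (@liftable_sub _ m (fun g => z g - coboundary v' g)).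
    exact/cocycleB/coboundary_cocycle.
  move=> g gk; have gH : g \in H.
    by move: g gk; apply/subsetP; rewrite cycle_subG.
  apply: congr_mod_trans (congr_mod_sym (mE g gH)) _.
  by apply: congr_modB; [apply: sz | apply: congr_mod_refl].
exists (fun g => i (z g) - coboundary (- v') g).
  by apply: cocycleB; [apply: cocycle_additive | apply: coboundary_cocycle].
move=> g gH; have -> : coboundary (- v') g = - coboundary v' g.
  by rewrite /coboundary (raddfN (gl_act g)) opprD.
rewrite opprK -[s g](subrK (coboundary v' g)).
apply: congr_modD; last exact: congr_mod_refl.
apply: congr_mod_trans (mE g gH) _; exact/congr_mod_additive/mz.
Qed.

End ShortExactSequence.

Lemma sha_trivial_ses e (H : {group gT}) M E P :
    (0 < e)%N -> permutation_lattice P -> has_ses M E P ->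
  sha_trivial e H E <-> sha_trivial e H M.
Proof.
move=> e_gt0 permP [i [p [[iG pG] i_inj p_ker p_surj]]]; split.
  exact: (@sha_trivial_sub e M E P i p).
exact: (@sha_trivial_extension e M E P i p).
Qed.

Lemma sha_trivial_quasi_permutation_summand e (H : {group gT}) M N L :
    (0 < e)%N -> quasi_permutation L -> direct_summand N L -> equivalent M N ->
  sha_trivial e H M.
Proof.
move=> e_gt0 [P [Q [permP permQ sesL]]] sumN.
case=> E [P' [Q' [permP' permQ' sesM sesN]]].
apply/(sha_trivial_ses H e_gt0 permP' sesM).
apply/(sha_trivial_ses H e_gt0 permQ' sesN).
apply/(sha_trivial_summand sumN)/(sha_trivial_ses H e_gt0 permQ sesL).
exact: sha_trivial_permutation.
Qed.

End Lattices.

(** * The tensor square of the root lattice *)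

Section TensorMultiples.
Variables M N : zmodType.

Lemma tmulBl (x x' : M) (y : N) : tmul (x - x') y = tmul x y - tmul x' y.
Proof. by apply: (addIr (tmul x' y)); rewrite -tmulDl !subrK. Qed.

Lemma tmulMnl (x : M) (y : N) m : tmul (x *+ m) y = tmul x y *+ m.
Proof.
elim: m => [|m IHm]; first by rewrite !mulr0n -(subrr x) tmulBl subrr.
by rewrite !mulrS tmulDl IHm.
Qed.

End TensorMultiples.

Section RootVectors.
Variables (n : nat) (o : 'I_n).
Local Notation A := (root_lattice n).

Definition basis_coord (i : 'I_n) : int := (i == o)%:R.

Lemma sum_basis_coord : \sum_i basis_coord i = 1.
Proof.
by rewrite (bigD1 o) //= /basis_coord eqxx big1 ?addr0 // => i /negPf->.
Qed.

Lemma recenter_sum0 (f : 'I_n -> int) :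
  (\row_i (f i - (\sum_j f j) * basis_coord i) : 'rV[int]_n) \in @sum0 n.
Proof.
apply/eqP; under eq_bigr do rewrite mxE.
by rewrite sumrB -mulr_sumr sum_basis_coord mulr1 subrr.
Qed.

(** A total map to the root lattice, which is the identity on vectors of
    coordinate sum zero. *)
Definition recenter f : A := RootVec (recenter_sum0 f).

Lemma recenterE f i : \sum_j f j = 0 -> root_val (recenter f) 0 i = f i.
Proof. by move=> f0; rewrite mxE f0 mul0r subr0. Qed.

Lemma root_vecP (x y : A) :
  (forall i, root_val x 0 i = root_val y 0 i) -> x = y.
Proof. by move=> xy; apply/val_inj/rowP. Qed.

Lemma root_valD (x y : A) i :
  root_val (x + y) 0 i = root_val x 0 i + root_val y 0 i.
Proof. by rewrite [LHS]mxE. Qed.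

Lemma root_valN (x : A) i : root_val (- x) 0 i = - root_val x 0 i.
Proof. by rewrite [LHS]mxE. Qed.

Lemma root_valMn (x : A) m i : root_val (x *+ m) 0 i = root_val x 0 i * m%:Z.
Proof.
elim: m => [|m IHm]; first by rewrite mulr0n mulr0 [LHS]mxE.
by rewrite mulrS root_valD IHm intS mulrDr mulr1.
Qed.

Lemma root_val_act g (x : A) i : root_val (gl_act g x) 0 i = root_val x 0 (g i).
Proof. by rewrite /= mxE. Qed.

End RootVectors.

Section TensorMatrix.
Variable n : nat.
Local Notation A := (root_lattice n).

Lemma outer_biadditive :
  biadditive (fun x y : A => (root_val x)^T *m root_val y).
Proof.
split=> [x x' y|x y y'].
  by rewrite -mulmxDl -linearD.
by rewrite -mulmxDr.
Qed.

(** The inclusion of A (x) A in U (x) U, viewed as matrices.  Its image lies in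
    the matrices with zero row and column sums. *)
Definition tens_mx : {additive tensor A A -> 'M[int]_n} :=
  tens_lift_additive outer_biadditive.

Lemma tens_mx_tmul (x y : A) i j :
  tens_mx (tmul x y) i j = root_val x 0 i * root_val y 0 j.
Proof.
rewrite /tens_mx /= (tens_lift_tmul outer_biadditive) mxE big_ord1.
by rewrite mxE.
Qed.

Lemma tens_mxD (t u : tensor A A) i j :
  tens_mx (t + u) i j = tens_mx t i j + tens_mx u i j.
Proof. by rewrite raddfD mxE. Qed.

Lemma tens_mxB (t u : tensor A A) i j :
  tens_mx (t - u) i j = tens_mx t i j - tens_mx u i j.
Proof. by rewrite raddfB !mxE. Qed.

Lemma tens_mx_act g (t : tensor A A) i j :
  tens_mx (gl_act g t) i j = tens_mx t (g i) (g j).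
Proof.
move: t; apply: tens_ind => [|t u tE uE|x y].
- by rewrite !raddf0 !mxE.
- by rewrite (raddfB (gl_act g)) !tens_mxB tE uE.
by rewrite /= tensor_act_tmul !tens_mx_tmul !root_val_act.
Qed.

Lemma root_sum0 (x : A) : \sum_i root_val x 0 i = 0.
Proof. exact/eqP/root_valP. Qed.

Lemma tens_mx_row_sum (t : tensor A A) i : \sum_j tens_mx t i j = 0.
Proof.
move: t; apply: tens_ind => [|t u tE uE|x y].
- by rewrite raddf0 big1 // => j _; rewrite mxE.
- by under eq_bigr do rewrite tens_mxB; rewrite sumrB tE uE subrr.
by under eq_bigr do rewrite tens_mx_tmul; rewrite -mulr_sumr root_sum0 mulr0.
Qed.

Lemma tens_mx_col_sum (t : tensor A A) j : \sum_i tens_mx t i j = 0.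
Proof.
move: t; apply: tens_ind => [|t u tE uE|x y].
- by rewrite raddf0 big1 // => i _; rewrite mxE.
- by under eq_bigr do rewrite tens_mxB; rewrite sumrB tE uE subrr.
by under eq_bigr do rewrite tens_mx_tmul; rewrite -mulr_suml root_sum0 mul0r.
Qed.

End TensorMatrix.

Lemma sum_perm n (g : {perm 'I_n}) (f : 'I_n -> int) :
  \sum_i f (g i) = \sum_i f i.
Proof. by rewrite [RHS](reindex_inj (@perm_inj _ g)). Qed.

Definition fixed_by n (K : {set {perm 'I_n}}) (f : 'I_n -> int) : Prop :=
  forall g i, g \in K -> f (g i) = f i.

Lemma fixed_by_cycle n (h : {perm 'I_n}) f :
  (forall i, f (h i) = f i) -> fixed_by <[h]>%g f.
Proof.
move=> fh g i /cycleP[m ->]; elim: m i => [|m IHm] i; first by rewrite perm1.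
by rewrite expgS permM IHm fh.
Qed.

(** * A locally trivial class that is not trivial *)

Section NontrivialClass.
Variables (n : nat) (o : 'I_n) (H : {group {perm 'I_n}}) (p : nat) (k : int).
Hypothesis p_gt0 : (0 < p)%N.
Variable c0 : 'I_n -> int.
Hypothesis c0_fixed : fixed_by H c0.
Hypothesis c0_sum : \sum_i c0 i = k * p%:Z.
Local Notation A := (root_lattice n).
Local Notation e := (basis_coord o).

Definition root_diff (f : 'I_n -> int) (g : {perm 'I_n}) : A :=
  recenter o (fun i => f i - f (g i)).

Lemma root_diffE f g i : root_val (root_diff f g) 0 i = f i - f (g i).
Proof.
apply: (recenterE o (f := fun j => f j - f (g j)) i).
by rewrite sumrB sum_perm subrr.
Qed.

Lemma root_diffM f g h :
  root_diff f (g * h)%g = root_diff f g + gl_act g (root_diff f h).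
Proof.
apply: root_vecP => i.
by rewrite root_valD root_val_act !root_diffE permM; ring.
Qed.

(** The class of a g = k (g e - e) in H^1(H, A) is killed by p: p a is the
    coboundary g b - b of this vector b, because c0 is invariant. *)
Definition bockstein_base : A := recenter o (fun i => k * p%:Z * e i - c0 i).
Local Notation b := bockstein_base.

Lemma bockstein_baseE i : root_val b 0 i = k * p%:Z * e i - c0 i.
Proof.
apply: (recenterE o (f := fun j => k * p%:Z * e j - c0 j) i).
by rewrite sumrB -mulr_sumr sum_basis_coord mulr1 c0_sum subrr.
Qed.

(** The connecting map sends a to a class of H^2(H, A (x) A), and this cocycle
    mod p has that class as its Bockstein.  Lift a g to a g (x) e in A (x) U;
    then p (a g (x) e) - (g (b (x) e) - b (x) e) = g b (x) (e - g e) lies in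
    A (x) A. *)
Definition class_cocycle (g : {perm 'I_n}) : tensor A A :=
  tmul (gl_act g b) (root_diff e g).

Lemma class_cocycleP : cocycle p H class_cocycle.
Proof.
move=> g h gH hH.
exists (tmul (gl_act g (- root_diff (fun i => k * e i) h)) (root_diff e g)).
have -> : class_cocycle (g * h)%g = tmul (gl_act g (gl_act h b)) (root_diff e g)
    + gl_act g (class_cocycle h).
  by rewrite /class_cocycle root_diffM tmulDr gl_actM /= tensor_act_tmul.
rewrite opprD addrACA subrr addr0 -tmulBl -tmulMnl; congr tmul.
rewrite -(raddfB (gl_act g)) -(raddfMn (gl_act g)); congr gl_act.
apply: root_vecP => i; rewrite root_valD root_valMn !root_valN root_diffE.
by rewrite root_val_act !bockstein_baseE c0_fixed //; ring.
Qed.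

(** If h fixes a vector c of sum k, then a is the coboundary of d = k e - c in A
    on <h>.  The vector w = p d - b is then fixed by <h>, and
    g b = p g d - w there, so - w (x) (e - g e) is an exact lift. *)
Lemma class_cocycle_locally_liftable :
    (forall h, h \in H -> exists2 c : 'I_n -> int,
       forall i, c (h i) = c i & \sum_i c i = k) ->
  locally_liftable p H class_cocycle.
Proof.
move=> loc h hH; have [c c_fixed c_sum] := loc h hH.
pose d : A := recenter o (fun i => k * e i - c i).
have dE i : root_val d 0 i = k * e i - c i.
  apply: (recenterE o (f := fun j => k * e j - c j) i).
  by rewrite sumrB -mulr_sumr sum_basis_coord mulr1 c_sum subrr.
pose w := d *+ p - b.
have bE g : gl_act g b = gl_act g d *+ p - gl_act g w.
  by rewrite /w (raddfB (gl_act g)) (raddfMn (gl_act g)) opprB addrC subrK.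
have wE g : g \in <[h]>%g -> gl_act g w = w.
  move=> gh; have gH : g \in H.
    by move: g gh; apply/subsetP; rewrite cycle_subG.
  apply: root_vecP => i; rewrite root_val_act !root_valD !root_valN !root_valMn.
  rewrite !bockstein_baseE !dE c0_fixed // (fixed_by_cycle c_fixed) //; ring.
pose z g : tensor A A := - tmul w (root_diff e g).
exists z => [g g' gh g'h|g gh]; rewrite /z.
  have -> : gl_act g (- tmul w (root_diff e g') : tensor A A)
      = - tmul w (gl_act g (root_diff e g')).
    by rewrite (raddfN (gl_act g)) -{2}(wE g gh) /= tensor_act_tmul.
  by rewrite root_diffM tmulDr opprD; apply: congr_mod_refl.
exists (tmul (gl_act g d) (root_diff e g)).
by rewrite opprK /class_cocycle bE wE // tmulBl subrK tmulMnl.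
Qed.

(** A lift z, with s g - z g = p t g, makes Y g = a g (x) e - t g an exact
    cocycle in matrices, its p-fold multiple being z plus a coboundary.  Column
    sums of Y g are zero and its row sums are a g.  If w is a primitive of Y,
    then v, the row sums minus the column sums of w, has sum zero and satisfies
    a g = v - g v, so that k e + v is an H-invariant vector of sum k. *)
Lemma class_cocycle_not_liftable :
    (forall c, fixed_by H c -> \sum_i c i <> k) ->
  ~ liftable p H class_cocycle.
Proof.
move=> glob [z zP sz].
have /fin_all_exists[t tE] g :
    exists t, g \in H -> class_cocycle g - z g = t *+ p.
  by have [/sz[t]|] := boolP (g \in H); [exists t | exists 0].
pose Y (g : {perm 'I_n}) i j : int :=
  k * (e (g i) - e i) * e j - tens_mx n (t g) i j.
have pY g i j : g \in H -> Y g i j * p%:Z =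
    root_val b 0 (g i) * e (g j) - root_val b 0 i * e j + tens_mx n (z g) i j.
  move=> gH; rewrite mulrBl.
  have -> : tens_mx n (t g) i j * p%:Z
      = root_val b 0 (g i) * (e j - e (g j)) - tens_mx n (z g) i j.
    rewrite -[p%:Z]natz mulr_natr -mulmxnE -raddfMn -tE // tens_mxB.
    by rewrite tens_mx_tmul root_diffE root_val_act.
  by rewrite !bockstein_baseE c0_fixed //; ring.
have YM g h i j : g \in H -> h \in H ->
    Y (g * h)%g i j = Y g i j + Y h (g i) (g j).
  move=> gH hH; apply: (mulIf (x := p%:Z)); first by rewrite -lt0n.
  rewrite [RHS]mulrDl !pY ?groupM // (congr_mod0 (zP g h gH hH)) tens_mxD.
  by rewrite tens_mx_act !permM; ring.
(* Permutations compose from left to right, so the left action on indices is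
   through inverses. *)
pose act (g : {perm 'I_n}) (x : 'I_n * 'I_n) := (g^-1%g x.1, g^-1%g x.2).
have act1 x : act 1%g x = x by rewrite /act invg1 !perm1; case: x.
have actM g h x : act (g * h)%g x = act g (act h x).
  by rewrite /act invMg !permM.
have YP : fun_cocycle act 0 H (fun g x => Y g x.1 x.2).
  move=> g h gH hH [i j]; rewrite dvd0z /= YM //.
  by rewrite -!permM mulVg !perm1 subrr.
have [|w wP] := fun_cocycle_coboundary act1 actM YP.
  move=> g x gH gx.
  have YPg : fun_cocycle act 0 <[g]>%g (fun g x => Y g x.1 x.2).
    have /subsetP sgH : <[g]>%g \subset H by rewrite cycle_subG.
    by move=> h h' hg hg'; apply: YP; apply: sgH.
  by rewrite (fun_cocycle_fix act1 YPg gx).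
have YE g i j : g \in H -> Y g i j = w (i, j) - w (g i, g j).
  move=> gH; have := wP g (g i, g j) gH; rewrite dvd0z subr_eq0 => /eqP.
  by rewrite /act /= !permK.
pose v i := \sum_j w (i, j) - \sum_l w (l, i).
have vE g i : g \in H -> v i - v (g i) = k * (e (g i) - e i).
  move=> gH; transitivity (\sum_j Y g i j - \sum_l Y g l i).
    rewrite /v -(sum_perm g (fun j => w (g i, j))).
    rewrite -(sum_perm g (fun l => w (l, g i))) /=.
    rewrite (eq_bigr _ (fun j _ => YE g i j gH)) sumrB.
    by rewrite (eq_bigr _ (fun l _ => YE g l i gH)) sumrB; ring.
  rewrite sumrB tens_mx_row_sum -mulr_sumr sum_basis_coord.
  rewrite sumrB tens_mx_col_sum -mulr_suml -mulr_sumr sumrB.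
  by rewrite (sum_perm g e) subrr; ring.
apply: (glob (fun i => k * e i + v i)) => [g i gH|].
  by rewrite -[v (g i)](subKr (v i)) vE //; ring.
rewrite big_split /= -mulr_sumr sum_basis_coord sumrB.
by rewrite [X in _ - X]exchange_big /= subrr mulr1 addr0.
Qed.

Theorem root_tensor_sha_nontrivial :
    (forall h, h \in H -> exists2 c : 'I_n -> int,
       forall i, c (h i) = c i & \sum_i c i = k) ->
    (forall c, fixed_by H c -> \sum_i c i <> k) ->
  ~ sha_trivial p H (tensor A A).
Proof.
move=> loc glob sha; apply: (class_cocycle_not_liftable glob).
exact: sha class_cocycleP (class_cocycle_locally_liftable loc).
Qed.

End NontrivialClass.

(** * Actions of abelian groups on n points *)

Section AbelianActions.
Variables (W : finZmodType) (T : finType) (tr : W -> T -> T).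
Hypothesis tr0 : forall x, tr 0 x = x.
Hypothesis trD : forall w w' x, tr (w + w') x = tr w (tr w' x).

Definition enum_tr (w : W) (i : 'I_#|T|) : 'I_#|T| :=
  enum_rank (tr w (enum_val i)).

Lemma enum_tr_inj w : injective (enum_tr w).
Proof.
apply: (can_inj (g := enum_tr (- w))) => i.
by rewrite /enum_tr enum_rankK -trD addNr tr0 enum_valK.
Qed.

Definition tr_perm w : {perm 'I_#|T|} := perm (@enum_tr_inj w).

Lemma tr_permE w i : tr_perm w i = enum_rank (tr w (enum_val i)).
Proof. by rewrite permE. Qed.

Lemma tr_group_set : group_set [set tr_perm w | w : W].
Proof.
apply/group_setP; split=> [|_ _ /imsetP[w _ ->] /imsetP[w' _ ->]].
  apply/imsetP; exists 0 => //; apply/permP => i.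
  by rewrite tr_permE tr0 enum_valK perm1.
apply/imsetP; exists (w' + w) => //; apply/permP => i.
by rewrite permM !tr_permE enum_rankK trD.
Qed.

Definition tr_group := Group tr_group_set.

Lemma sum_enum_val (f : T -> int) : \sum_(i < #|T|) f (enum_val i) = \sum_x f x.
Proof.
rewrite (reindex_onto (@enum_rank T) (@enum_val T T)) => [|i _].
  by apply: eq_big => [x|x _]; rewrite enum_rankK ?eqxx.
exact: enum_valK.
Qed.

Lemma abelian_action_sha_nontrivial (o : T) (p : nat) (k : int)
    (c0 : T -> int) :
    (0 < p)%N -> (forall w x, c0 (tr w x) = c0 x) -> \sum_x c0 x = k * p%:Z ->
    (forall w, exists2 c : T -> int,
       forall x, c (tr w x) = c x & \sum_x c x = k) ->
    (forall c : T -> int, (forall w x, c (tr w x) = c x) -> \sum_x c x <> k) ->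
  ~ sha_trivial p tr_group (tensor (root_lattice #|T|) (root_lattice #|T|)).
Proof.
move=> p_gt0 c0_fixed c0_sum loc glob.
apply: (@root_tensor_sha_nontrivial _ (enum_rank o) _ _ k p_gt0
  (c0 \o enum_val)).
- by move=> _ i /imsetP[w _ ->] /=; rewrite tr_permE enum_rankK c0_fixed.
- by rewrite (sum_enum_val c0).
- move=> _ /imsetP[w _ ->]; have [c c_fixed c_sum] := loc w.
  exists (c \o enum_val); last by rewrite (sum_enum_val c).
  by move=> i /=; rewrite tr_permE enum_rankK c_fixed.
move=> c c_fixed; have <- : \sum_x c (enum_rank x) = \sum_i c i.
  rewrite -(sum_enum_val (c \o enum_rank)).
  by apply: eq_bigr => i _ /=; rewrite enum_valK.
apply: (glob (c \o enum_rank)) => w x /=.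
rewrite -[RHS](c_fixed (tr_perm w)) ?imset_f //.
by rewrite tr_permE enum_rankK.
Qed.

End AbelianActions.

Lemma int_multiple_neq1 (a : int) (p : nat) : (1 < p)%N -> a * p%:Z <> 1.
Proof.
move=> p_gt1 /(congr1 absz)/eqP; rewrite abszM muln_eq1 => /andP[_ /eqP p1].
by move: p_gt1; rewrite -[p]/`|p%:Z|%N p1.
Qed.

(** * The two actions of F_p^2 *)

Section Instances.
Variable p : nat.
Hypothesis p_pr : prime p.
Local Notation W := 'rV['F_p]_2.

Lemma sum_pred1 (T : finType) (a : T) : \sum_x (x == a)%:R = 1 :> int.
Proof. by rewrite (bigD1 a) //= eqxx big1 ?addr0 // => i /negPf->. Qed.

(** F_p^2 acting on itself, with k = p.  The line t |-> t w, counted with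
    multiplicity p when w = 0, is a w-invariant vector of sum p. *)
Lemma regular_sha_nontrivial :
  exists H : {group {perm 'I_#|{: W}|}},
    ~ sha_trivial p H (tensor (root_lattice #|{: W}|) (root_lattice #|{: W}|)).
Proof.
have p_gt1 := prime_gt1 p_pr.
have cardW : #|{: W}| = (p * p)%N by rewrite card_mx card_Fp.
have tr0 (x : W) : 0 + x = x by rewrite add0r.
have trD (w w' x : W) : (w + w') + x = w + (w' + x) by rewrite addrA.
exists (@tr_group W W +%R tr0 trD).
apply: (@abelian_action_sha_nontrivial W W _ _ _ 0 _ p (fun=> 1)) => //.
- exact: prime_gt0.
- by rewrite sumr_const cardW natrM !natz.
- move=> w; exists (fun x => \sum_(t : 'F_p) (x == t *: w)%:R) => [x|].
    rewrite (reindex_inj (addrI 1)); apply: eq_bigr => t _.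
    by rewrite scalerDl scale1r (inj_eq (addrI w)).
  rewrite exchange_big (eq_bigr (fun=> 1)) => [|t _]; last exact: sum_pred1.
  by rewrite sumr_const card_Fp // natz.
move=> c c_fixed; rewrite (eq_bigr (fun=> c 0)) => [|x _]; last first.
  by rewrite -(c_fixed x 0) addr0.
rewrite sumr_const cardW -mulr_natr natz PoszM mulrA -[RHS]mul1r => ap.
by apply: (int_multiple_neq1 p_gt1 (a := c 0)); apply: mulIf ap; lia.
Qed.

(** F_p^2 acts on m copies of F_p, the j-th through the linear form u_j.  The
    kernels of the forms w_0 + j w_1, for j < p, and w_1, for j >= p, cover
    F_p^2, so each w fixes a whole copy. *)
Lemma shear_sha_nontrivial m : (p < m)%N ->
  let T := ('I_m * 'F_p)%type in
  exists H : {group {perm 'I_#|{: T}|}},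
    ~ sha_trivial p H (tensor (root_lattice #|{: T}|) (root_lattice #|{: T}|)).
Proof.
move=> p_m T; have p_gt1 := prime_gt1 p_pr.
pose u (j : 'I_m) (w : W) := if (j < p)%N then w 0 0 + w 0 1 * j%:R else w 0 1.
have uD j w w' : u j (w + w') = u j w + u j w'.
  by rewrite /u !mxE; case: ifP => // _; ring.
pose tr (w : W) (x : T) : T := (x.1, u x.1 w + x.2).
have tr0 x : tr 0 x = x.
  by case: x => j r; rewrite /tr /u /= !mxE mul0r addr0 if_same add0r.
have trD w w' x : tr (w + w') x = tr w (tr w' x) by rewrite /tr /= uD addrA.
have sumT (f : T -> int) : \sum_x f x = \sum_j \sum_r f (j, r).
  by rewrite pair_big; apply: eq_bigr => -[].
pose jp := Ordinal p_m.
exists (@tr_group W T tr tr0 trD).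
apply: (@abelian_action_sha_nontrivial W T _ _ _ (jp, 0) _ 1
  (fun x => (x.1 == jp)%:R)) => //.
- exact: prime_gt0.
- rewrite sumT (eq_bigr (fun j => (j == jp)%:R * p%:Z)) => [|j _].
    by rewrite -mulr_suml sum_pred1.
  by rewrite /= sumr_const card_Fp // -[p%:Z]natz mulr_natr.
- move=> w; have [j uj] : exists j, u j w = 0.
    have [w0|w_n0] := eqVneq (w 0 1) 0; first by exists jp; rewrite /u /= ltnn.
    have [a aE] : exists a, w 0 0 + w 0 1 * a = 0.
      by exists (- w 0 0 / w 0 1); rewrite mulrC divfK // subrr.
    have a_lt : (a < p)%N.
      by have := ltn_ord a; rewrite [X in (_ < X)%N -> _](Fp_cast p_pr).
    by exists (Ordinal (ltn_trans a_lt p_m)); rewrite /u /= a_lt natr_Zp.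
  exists (fun x => (x == (j, 0))%:R) => [[j' r]|]; last exact: sum_pred1.
  rewrite /tr /= !xpair_eqE; case: eqP => // ->.
  by rewrite uj add0r.
move=> c c_fixed; rewrite sumT (eq_bigr (fun j => c (j, 0) * p%:Z)) => [|j _].
  by rewrite -mulr_suml; apply: int_multiple_neq1.
rewrite (eq_bigr (fun=> c (j, 0))) => [|r _].
  by rewrite /= sumr_const card_Fp // -[p%:Z]natz mulr_natr.
pose w : W := r *: delta_mx 0 (if (j < p)%N then 0 else 1).
have uw : u j w = r.
  rewrite /u /w !mxE.
  by case: (j < p)%N; rewrite /= ?mulr1 ?mulr0 ?mul0r ?addr0.
by rewrite -(c_fixed w (j, 0)) /tr /= uw addr0.
Qed.

End Instances.

(** Taking p to be the least prime factor ensures that the cofactor m is at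
    least p: for m > p there are then enough orbits for the p + 1 kernels. *)
Lemma composite_sha_nontrivial n : (2 <= n)%N -> ~~ prime n ->
  exists2 p, (0 < p)%N & exists H : {group {perm 'I_n}},
    ~ sha_trivial p H (tensor (root_lattice n) (root_lattice n)).
Proof.
move=> n_gt1 n_nprime; pose p := pdiv n.
have p_pr : prime p by apply: pdiv_prime.
have [m nE] : exists m, n = (m * p)%N by apply/dvdnP/pdiv_dvd.
have p_le_m : (p <= m)%N.
  have : (p ^ 2 <= n)%N.
    by rewrite leqNgt; apply: contra n_nprime; apply: ltn_pdiv2_prime; lia.
  by rewrite nE -mulnn leq_pmul2r ?prime_gt0.
exists p; first exact: prime_gt0.
move: p_le_m; rewrite leq_eqVlt => /predU1P[mE|p_lt_m].
  have -> : n = #|{: 'rV['F_p]_2}| by rewrite card_mx card_Fp // nE -mE.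
  exact: regular_sha_nontrivial.
have -> : n = #|{: 'I_m * 'F_p}| by rewrite card_prod card_Fp // card_ord.
exact: shear_sha_nontrivial.
Qed.

Theorem corollary4p1 (n : nat) (n_ge2 : (2 <= n)%N) (n_nprime : ~~ prime n) :
  ~ exists N L : glattice {perm 'I_n},
      [/\ quasi_permutation L,
          direct_summand N L
        & equivalent (tensor (root_lattice n) (root_lattice n)) N].
Proof.
case=> N [L [qpL sumN eqN]].
have [p p_gt0 [H]] := composite_sha_nontrivial n_ge2 n_nprime; apply.
exact: sha_trivial_quasi_permutation_summand p_gt0 qpL sumN eqN.
Qed.
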